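(* Let $d\ge1$ and let $S\subseteq(0,1)^d$ be arbitrary. Then there is a residual subset $\mathcal{F}$ of $\operatorname{Lip}_1([0,1]^d,\mathbb{R})$ such that for every $f\in\mathcal{F}$ the set of non-differentiability points of $f$ in $S$ is residual in $S$.
   Context: $\operatorname{Lip}_1([0,1]^d,\mathbb{R})$ is the set of functions $f\colon[0,1]^d\to\mathbb{R}$ that are Lipschitz with Lipschitz constant at most $1$ with respect to the Euclidean norm on $\mathbb{R}^d$, with the metric induced by the supremum norm $\|f\|_\infty=\sup_{x\in[0,1]^d}|f(x)|$. A subset of a topological space is residual if its complement is of first Baire category; ''residual in $S$'' refers to the subspace topology of $S$. *)

(* Defs.v *)
From HB Require Import structures.
From mathcomp Require Import all_boot all_order all_algebra.
From mathcomp Require Import all_classical all_reals all_analysis.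

Set Implicit Arguments.
Unset Strict Implicit.
Unset Printing Implicit Defensive.

Import Order.TTheory GRing.Theory Num.Theory.
Import numFieldNormedType.Exports.

Local Open Scope classical_set_scope.
Local Open Scope ring_scope.

Definition nowhere_dense (T : topologicalType) (A : set T) : Prop :=
  (closure A)° = set0.

Definition first_category (T : topologicalType) (A : set T) : Prop :=
  exists N : (set T)^nat,
    (forall n, nowhere_dense (N n)) /\ A = \bigcup_n N n.

Definition residual (T : topologicalType) (A : set T) : Prop :=
  first_category (~` A).

(* [set_type B] carries the subspace topology, i.e., the initial topology of
   the inclusion [set_val]; the type [subspace B] would not do here, since it
   also contains the points outside of B, as isolated points. *)
Definition residual_in (T : topologicalType) (B A : set T) : Prop :=
  residual (set_val @^-1` A : set (set_type B)).

(* The norm of the normed module ['rV[R]_d] is the max norm. It induces the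
   same topology, and the same notion of differentiability, as the Euclidean
   norm, but not the same Lipschitz constants. *)
Definition euclidean_norm (R : realType) (d : nat) (x : 'rV[R]_d) : R :=
  Num.sqrt (\sum_(i < d) x ord0 i ^+ 2).

Definition closed_cube (R : realType) (d : nat) : set 'rV[R]_d :=
  [set x | forall i, 0 <= x ord0 i <= 1].

Definition open_cube (R : realType) (d : nat) : set 'rV[R]_d :=
  [set x | forall i, 0 < x ord0 i < 1].

(* All functions from the closed cube to R, with the topology of uniform
   convergence; on bounded functions it is induced by the supremum norm. *)
Definition cube_fun (R : realType) (d : nat) : topologicalType :=
  {uniform set_type (@closed_cube R d) -> R}.

Definition Lip1 (R : realType) (d : nat) : set (cube_fun R d) :=
  [set f : set_type (@closed_cube R d) -> R |
    forall x y, `|f x - f y| <= euclidean_norm (set_val x - set_val y)].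

(* [f] is extended by 0 outside of the closed cube in order to apply the
   library's [differentiable]; the extension is irrelevant at the points of the
   open cube, the only ones at which this definition is meant to be used. *)
Definition non_differentiability (R : realType) (d : nat) (f : cube_fun R d) :
    set 'rV[R]_d :=
  [set x | ~ differentiable
               ('valL_ (0 : R) (f : set_type (@closed_cube R d) -> R)) x].

Arguments closed_cube : clear implicits.
Arguments open_cube : clear implicits.
Arguments Lip1 : clear implicits.

(* Main.v *)
Require Import Defs.
From mathcomp Require Import all_boot all_order all_algebra.
From mathcomp Require Import all_classical all_reals all_analysis.
From mathcomp Require Import ring lra.

Import Order.TTheory GRing.Theory Num.Theory.
Import numFieldNormedType.Exports.

Local Open Scope classical_set_scope.

(** Fix a unit vector [e] and write [second_difference F e x r] for
    [F (x + r e) + F (x - r e) - 2 F x]. If [F] is differentiable at [x], this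
    is [o(r)]. Hence [x] is a point of non-differentiability of [f] as soon as
    the second difference of [f] at [x] exceeds [r] for arbitrarily small
    [r > 0], that is, as soon as [kink e f n x] holds for every [n]
    ([kinks_nondifferentiable]).

    The condition [kink e f n x] is open in both of its arguments
    ([kink_open_fun], [kink_open_point]), which gives two applications of the
    same category argument ([residual_countable_bigcap]). Take a countable
    dense subset [D] of [S] ([countable_dense_subset]), and let [T] be the set
    of the 1-Lipschitz [f] with [kink e f n p] for all [p] in [D] and all [n].

    - [T] is residual, being a countable intersection of sets that are open and
      also dense: given a 1-Lipschitz [f], a point [p] and [c > 0], the function
      [y |-> max (f y) (f p + c - |y - p|)] is 1-Lipschitz, lies within [c] of
      [f], and coincides with the cone [f p + c - |y - p|] near [p], so that its
      second difference at [p] is [- 2 r] for all small [r] ([cone_max_lip],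
      [cone_max_close], [cone_max_kink]).
    - For [f] in [T], the points [x] of [S] with [kink e f n x] for every [n]
      form a countable intersection of relatively open sets, each of which
      contains [D] and so is dense in [S]. *)

(** * Baire category and separability *)

Section Category.
Local Open Scope ring_scope.

(** Each [~` G i] is closed with empty interior, hence nowhere dense together
    with all of its subsets. The set [A] is only assumed to contain the
    intersection, because points may be non-differentiable without having kinks. *)
Lemma residual_countable_bigcap (T : topologicalType) (I : Type) (D : set I)
    (G : I -> set T) (A : set T) :
  countable D -> (forall i, D i -> open (G i)) ->
  (forall i, D i -> dense (G i)) -> \bigcap_(i in D) G i `<=` A -> residual A.
Proof.
move=> /pfcard_geP[->|[f]] oG dG GA.
  exists (fun=> set0); split=> [n|].
    by rewrite /nowhere_dense closure0 interior0.
  rewrite bigcup0// (_ : A = setT) ?setCT//.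
  by rewrite -subTset => x _; apply: GA => i [].
(* The complement of [A] is cut along the closed sets [~` G (f k)], since
   these alone may cover more than it. *)
exists (fun k => ~` A `&` ~` G (f k)); split=> [n|].
  rewrite /nowhere_dense -subset0 => x xN.
  have Dfn : D (f n) by exact: funS.
  have cN : closure (~` A `&` ~` G (f n)) `<=` ~` G (f n).
    by rewrite closureE; apply: smallest_sub; [exact/open_closedC/oG|exact: subIsetr].
  have [y [/interior_subset/cN]] :=
    dG _ Dfn _ (ex_intro _ x xN) (open_interior _).
  by [].
rewrite eqEsubset; split=> x; last by case=> k _ [].
move=> nAx.
apply: contrapT => nx; apply: (nAx); apply: GA => i Di.
have [k _ <-] := @surj _ _ _ _ f i Di.
by apply: contrapT => nG; apply: nx; exists k.
Qed.

(** The points of [D] are chosen in [S], one in each nonempty intersection of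
    [S] with a ball of rational centre and radius [1 / (n + 1)]: rational points
    themselves need not belong to [S]. *)
Lemma countable_dense_subset (R : realType) (d : nat) (S : set 'rV[R]_d) :
  exists D : set 'rV[R]_d, [/\ countable D, D `<=` S &
    forall x, S x -> forall e : R, 0 < e -> exists2 p, D p & ball x e p].
Proof.
pose B (i : 'rV[rat]_d * nat) : set 'rV[R]_d :=
  S `&` ball (map_mx ratr i.1 : 'rV[R]_d) i.2.+1%:R^-1.
pose u i := xget 0 (B i).
exists (u @` [set i | B i !=set0]); split.
- by apply: card_le_trans (card_image_le _ _) _; exact: countableP.
- move=> _ [i [x Bx] <-]; rewrite /u.
  by have [] := xgetPex 0 (ex_intro (B i) x Bx).
move=> x Sx e e0.
have /ltr_add_invr[n] : 0 < e / 2 by rewrite divr_gt0.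
rewrite add0r => n0.
pose t : R := n.+1%:R^-1.
have t0 : 0 < t by rewrite invr_gt0 ltr0n.
have /choice[q qx] (j : 'I_d) : exists q : rat, ball (x ord0 j) t (ratr q : R).
  have /rat_in_itvoo[q] : x ord0 j < x ord0 j + t by rewrite ltrDl.
  rewrite in_itv/= => /andP[q1 q2]; exists q.
  by rewrite /ball/= ltr_norml; apply/andP; split; lra.
have qB : ball x t (map_mx ratr (\row_j q j) : 'rV[R]_d).
  by split=> // i j; rewrite !mxE ord1; exact: qx.
have Bx : B (\row_j q j, n) x by split=> //; exact: ball_sym.
exists (u (\row_j q j, n)); first by exists (\row_j q j, n) => //; exists x.
have [_ Bu] := xgetPex 0 (ex_intro (B _) x Bx).
apply: (@le_ball _ _ _ (t + t)); first by move: n0; rewrite -/t; lra.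
exact: ball_triangle Bu.
Qed.

End Category.

(** * The Euclidean norm and the topology of the cube *)

Section Euclid.
Local Open Scope ring_scope.
Context {R : realType} {d : nat}.
Implicit Types (x y z e : 'rV[R]_d).

Lemma euclidean_norm_ge0 x : 0 <= euclidean_norm x.
Proof. exact: sqrtr_ge0. Qed.

Lemma euclidean_normE x : euclidean_norm x ^+ 2 = \sum_(i < d) x ord0 i ^+ 2.
Proof. by rewrite sqr_sqrtr// sumr_ge0// => i _; exact: sqr_ge0. Qed.

Lemma euclidean_norm_eq0 x : euclidean_norm x = 0 -> x = 0.
Proof.
move=> /eqP; rewrite sqrtr_eq0 => x0; apply/rowP => i; rewrite mxE.
have := le_trans _ x0 => /(_ (x ord0 i ^+ 2)).
rewrite (bigD1 i)//= lerDl sumr_ge0 => [/(_ isT)|j _]; last exact: sqr_ge0.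
by move=> h; apply/eqP; rewrite -sqrf_eq0 eq_le h sqr_ge0.
Qed.

Lemma euclidean_normZ (r : R) x :
  euclidean_norm (r *: x) = `|r| * euclidean_norm x.
Proof.
rewrite /euclidean_norm -sqrtr_sqr -sqrtrM ?sqr_ge0// mulr_sumr.
by congr Num.sqrt; apply: eq_bigr => i _; rewrite mxE exprMn.
Qed.

Lemma euclidean_norm0 : euclidean_norm (0 : 'rV[R]_d) = 0.
Proof. by rewrite -(scale0r (0 : 'rV[R]_d)) euclidean_normZ normr0 mul0r. Qed.

Lemma euclidean_normN x : euclidean_norm (- x) = euclidean_norm x.
Proof. by rewrite -scaleN1r euclidean_normZ normrN1 mul1r. Qed.

(** With [a] and [b] the norms of [x] and [y], expanding the squared norm of
    [a y - b x] gives [0 <= 2 a b (a b - <x, y>)]. *)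
Lemma euclidean_cauchy_schwarz x y :
  \sum_(i < d) x ord0 i * y ord0 i <= euclidean_norm x * euclidean_norm y.
Proof.
set a := euclidean_norm x; set b := euclidean_norm y.
have [/euclidean_norm_eq0->|a0] := eqVneq a 0.
  rewrite big1 ?mulr_ge0 ?euclidean_norm_ge0// => i _.
  by rewrite mxE mul0r.
have [/euclidean_norm_eq0->|b0] := eqVneq b 0.
  rewrite big1 ?mulr_ge0 ?euclidean_norm_ge0// => i _.
  by rewrite mxE mulr0.
have ab0 : 0 < a * b by rewrite mulr_gt0 ?lt0r ?a0 ?b0 ?euclidean_norm_ge0.
have : 0 <= \sum_(i < d) (a * y ord0 i - b * x ord0 i) ^+ 2.
  by apply: sumr_ge0 => i _; exact: sqr_ge0.
have -> : \sum_(i < d) (a * y ord0 i - b * x ord0 i) ^+ 2 =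
    2 * (a * b) * (a * b - \sum_(i < d) x ord0 i * y ord0 i).
  transitivity (a ^+ 2 * b ^+ 2 + b ^+ 2 * a ^+ 2
      - 2 * (a * b) * \sum_(i < d) x ord0 i * y ord0 i); last by ring.
  rewrite [in LHS](eq_bigr (fun i => a ^+ 2 * y ord0 i ^+ 2 +
    b ^+ 2 * x ord0 i ^+ 2 - 2 * (a * b) * (x ord0 i * y ord0 i))).
    by rewrite sumrB big_split/= -!mulr_sumr -!euclidean_normE.
  by move=> i _; ring.
have ab2 : 0 < 2 * (a * b) by rewrite mulr_gt0.
by rewrite (pmulr_rge0 _ ab2) subr_ge0.
Qed.

Lemma ler_euclidean_normD x y :
  euclidean_norm (x + y) <= euclidean_norm x + euclidean_norm y.
Proof.
rewrite -ler_sqr ?nnegrE ?addr_ge0 ?euclidean_norm_ge0//.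
rewrite sqrrD !euclidean_normE.
have -> : \sum_(i < d) (x + y) ord0 i ^+ 2 = \sum_(i < d) x ord0 i ^+ 2 +
    (\sum_(i < d) x ord0 i * y ord0 i) *+ 2 + \sum_(i < d) y ord0 i ^+ 2.
  rewrite -sumrMnl -!big_split; apply: eq_bigr => i _.
  by rewrite mxE sqrrD.
by rewrite lerD2r lerD2l lerMn2r euclidean_cauchy_schwarz.
Qed.

Lemma euclidean_norm_continuous : continuous (@euclidean_norm R d).
Proof.
have coord2 (i : 'I_d) : continuous (fun y : 'rV[R]_d => y ord0 i ^+ 2).
  move=> y; apply: (@continuous_comp _ _ _ (fun y : 'rV[R]_d => y ord0 i)
    (fun t : R => t ^+ 2)); first exact: coord_continuous.
  exact: exprn_continuous.
move=> x; apply: (@continuous_comp _ _ _ _ Num.sqrt); last exact: sqrt_continuous.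
move: x; apply: continuous_big => [|i _]; first exact: add_continuous.
exact: coord2.
Qed.

Lemma open_open_cube : open (open_cube R d).
Proof.
rewrite openE => x cx; rewrite /interior.
apply: (@filter_forall _ _ (fun i (y : 'rV[R]_d) => 0 < y ord0 i < 1) (nbhs x)
  (nbhs_filter x)) => i.
apply: (@coord_continuous R 1 d ord0 i x `]0, 1[%classic).
apply: open_nbhs_nbhs; split; first exact: interval_open.
by rewrite /= in_itv/=; exact: cx.
Qed.

End Euclid.

(** * Second differences and kinks *)

Section Kinks.
Local Open Scope ring_scope.
Context {R : realType} {d : nat}.
Implicit Types (f g : cube_fun R d) (x y z p e : 'rV[R]_d).

Definition zero_ext f : 'rV[R]_d -> R :=
  'valL_ (0 : R) (f : set_type (closed_cube R d) -> R).

Definition second_difference (F : 'rV[R]_d -> R) e x (r : R) : R :=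
  F (x + r *: e) + F (x - r *: e) - 2 * F x.

(** The bound [1 / (n + 1)] on the scale makes the requirement for all [n] one
    at arbitrarily small scales. A single strict inequality at a single [r] is
    what makes the condition open, and the three points are kept in the open
    cube because only there are small perturbations of [x] harmless. *)
Definition kink e f (n : nat) x : Prop :=
  exists r : R, [/\ 0 < r < n.+1%:R^-1,
    [/\ open_cube R d x, open_cube R d (x + r *: e)
      & open_cube R d (x - r *: e)] &
    r < `|second_difference (zero_ext f) e x r|].

Lemma open_cubeW : open_cube R d `<=` closed_cube R d.
Proof. by move=> x cx i; have /andP[/ltW-> /ltW->] := cx i. Qed.

Lemma zero_extE f (x : set_type (closed_cube R d)) : zero_ext f (set_val x) = f x.
Proof. by have := congr1 (fun g => g x) (valLK (0 : R) f). Qed.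

Lemma zero_ext_set_type f x : closed_cube R d x ->
  exists2 u : set_type (closed_cube R d), set_val u = x & zero_ext f x = f u.
Proof.
move=> cx; exists (SigSub (mem_set cx)) => //.
exact: (zero_extE f (SigSub (mem_set cx))).
Qed.

Lemma zero_ext_lip f x y : Lip1 R d f -> closed_cube R d x -> closed_cube R d y ->
  `|zero_ext f x - zero_ext f y| <= euclidean_norm (x - y).
Proof.
by move=> Lf /(zero_ext_set_type f)[u <- ->] /(zero_ext_set_type f)[v <- ->]; exact: Lf.
Qed.

Lemma zero_ext_continuous f x : Lip1 R d f -> open_cube R d x ->
  {for x, continuous (zero_ext f)}.
Proof.
move=> Lf cx; rewrite /prop_for /continuous_at.
apply: (cvgrPdist_lt (F := nbhs x) _ _).2 => eps eps0; near=> y.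
have cy : open_cube R d y.
  by near: y; exact: open_nbhs_nbhs (conj open_open_cube cx).
have := zero_ext_lip f x y Lf (open_cubeW _ cx) (open_cubeW _ cy).
move=> /le_lt_trans; apply; near: y.
have : {for x, continuous (fun y : 'rV[R]_d => euclidean_norm (x - y))}.
  apply: (@continuous_comp _ _ _ (fun y : 'rV[R]_d => x - y)); last first.
    exact: euclidean_norm_continuous.
  by apply: continuousB; [exact: cst_continuous|exact: cvg_id].
rewrite /prop_for /continuous_at subrr euclidean_norm0.
by move=> /(cvgr_lt (F := nbhs x)); exact.
Unshelve. all: by end_near. Qed.

(** The second difference involves four values of [f], with multiplicity, so
    it moves by less than [4 del] when [f] moves by less than [del]; hence the
    quarter in the choice of [del]. *)
Lemma kink_open_fun e (n : nat) x : open [set f | kink e f n x].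
Proof.
rewrite openE => f [r [r0 cube rf]]; rewrite /interior.
pose del := (`|second_difference (zero_ext f) e x r| - r) / 4.
have del0 : 0 < del by rewrite /del divr_gt0// subr_gt0.
apply/uniform_nbhs; exists [set uv : R * R | ball uv.1 del uv.2].
split; first exact: (entourage_ball _ (PosNum del0)).
move=> g /= fg; exists r; split => //.
have cfg y : open_cube R d y -> `|zero_ext f y - zero_ext g y| < del.
  by move=> /open_cubeW/(zero_ext_set_type f)[u <- ->]; rewrite zero_extE; exact: fg.
have [c0 c1 c2] := cube.
have close : `|second_difference (zero_ext f) e x r -
    second_difference (zero_ext g) e x r| < 4 * del.
  move: (cfg _ c0) (cfg _ c1) (cfg _ c2); rewrite /second_difference !ltr_norml.
  by move=> /andP[? ?] /andP[? ?] /andP[? ?]; apply/andP; split; lra.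
have := ler_normD (second_difference (zero_ext f) e x r -
  second_difference (zero_ext g) e x r) (second_difference (zero_ext g) e x r).
by move: close; rewrite subrK /del; lra.
Qed.

Lemma translation_continuous v : continuous (fun y : 'rV[R]_d => y + v).
Proof.
move=> x; apply: (@continuousD _ _ _ (fun y : 'rV[R]_d => y)).
  exact: cvg_id.
exact: cst_continuous.
Qed.

Lemma second_difference_continuous e (F : 'rV[R]_d -> R) x (r : R) :
  {for x, continuous F} -> {for x + r *: e, continuous F} ->
  {for x - r *: e, continuous F} ->
  {for x, continuous (fun y => second_difference F e y r)}.
Proof.
move=> F0 F1 F2; apply: continuousB; last first.
  by apply: continuousM; [exact: cst_continuous|].
apply: continuousD.
  apply: (@continuous_comp _ _ _ (fun y => y + r *: e) F) => //.
  exact: translation_continuous.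
apply: (@continuous_comp _ _ _ (fun y => y - r *: e) F) => //.
exact: translation_continuous.
Qed.

(** A 1-Lipschitz function is continuous in the open cube, so for a fixed scale
    [r] the second difference is continuous in the base point. *)
Lemma kink_open_point e f (n : nat) : Lip1 R d f -> open [set x | kink e f n x].
Proof.
move=> Lf; rewrite openE => x [r [r0 [c0 c1 c2] rf]]; rewrite /interior.
have near_cube v : open_cube R d (x + v) -> nbhs x [set y | open_cube R d (y + v)].
  move=> cv; apply: (@translation_continuous v x (open_cube R d)).
  exact: open_nbhs_nbhs (conj open_open_cube cv).
have cv : {for x, continuous (fun y => `|second_difference (zero_ext f) e y r|)}.
  apply: (@continuous_comp _ _ _ (fun y => second_difference (zero_ext f) e y r)).
    by apply: second_difference_continuous; exact: zero_ext_continuous.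
  exact: norm_continuous.
have near_gt := cvgr_gt (F := nbhs x) _ cv _ rf.
near=> y; exists r; split=> //; last by near: y; exact: near_gt.
split; near: y; [|exact: near_cube|exact: near_cube].
exact: open_nbhs_nbhs (conj open_open_cube c0).
Unshelve. all: by end_near. Qed.

(** The difference quotients along [e] at [r] and at [- r] are both within
    [1 / 2] of the directional derivative, and the second difference is [r]
    times the difference of these two quotients. *)
Lemma derivable_second_difference (F : 'rV[R]_d -> R) e x : derivable F x e ->
  \forall r \near 0^'+, `|second_difference F e x r| <= r.
Proof.
move=> /cvg_ex[/= l].
move=> /cvgrPdist_lt/(_ 2^-1); rewrite invr_gt0 => /(_ (ltr0Sn _ _)).
move=> /nbhs_ballP[del /= del0 Hdel].
near=> r.
have r0 : 0 < r by near: r; exact: nbhs_right_gt.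
have rdel : r < del by near: r; exact: nbhs_right_lt.
have := Hdel r; rewrite /ball/= sub0r normrN gtr0_norm//.
move=> /(_ rdel (lt0r_neq0 r0)).
have := Hdel (- r); rewrite /ball/= sub0r opprK gtr0_norm// oppr_eq0.
move=> /(_ rdel (lt0r_neq0 r0)).
rewrite invrN [- r *: e + x]addrC [r *: e + x]addrC !scaleNr.
rewrite /second_difference.
move: (F (x + _)) (F (x - _)) (F x) => a b c.
rewrite -![r^-1 *: _]/(r^-1 * _) => h1 h2.
have -> : a + b - 2 * c =
    r * ((l - - (r^-1 * (b - c))) - (l - r^-1 * (a - c))).
  by field; exact: lt0r_neq0.
rewrite normrM gtr0_norm// ler_piMr// ?(ltW r0)//.
by apply: le_trans (ler_normB _ _) _; lra.
Unshelve. all: by end_near. Qed.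

Lemma kinks_nondifferentiable e f x : (forall n, kink e f n x) ->
  non_differentiability f x.
Proof.
move=> kx /(@diff_derivable _ _ _ _ _ e)/derivable_second_difference.
move=> [del /= del0 small].
have [n] := ltr_add_invr del0; rewrite add0r => n0.
have [r [/andP[r0 rn] _]] := kx n.
apply/negP; rewrite -leNgt; apply: small => //=.
by rewrite sub0r normrN gtr0_norm// (lt_trans rn).
Qed.

(** * Raising a cone above a Lipschitz function *)

Definition cone_max f p (c : R) : cube_fun R d :=
  fun y : set_type (closed_cube R d) =>
    Num.max ((f : set_type (closed_cube R d) -> R) y)
      (c - euclidean_norm (set_val y - p)).

(** The cone is 1-Lipschitz by the triangle inequality, and the maximum of two
    1-Lipschitz functions is 1-Lipschitz. *)
Lemma cone_max_lip f p c : Lip1 R d f -> Lip1 R d (cone_max f p c).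
Proof.
move=> Lf x y; rewrite /cone_max.
have := Lf x y.
have := ler_euclidean_normD (set_val x - set_val y) (set_val y - p).
have := ler_euclidean_normD (set_val y - set_val x) (set_val x - p).
rewrite !subrKA -(opprB (set_val x)) euclidean_normN.
move: (euclidean_norm (_ x - _ y)) (euclidean_norm (_ x - p)) => D a.
move: (euclidean_norm (_ y - p)) => b h1 h2; rewrite !ler_norml.
move=> /andP[h3 h4]; apply/andP.
by case: (leP (f x)) => h5; case: (leP (f y)) => h6; split; lra.
Qed.

(** As [f] is 1-Lipschitz, it lies above the cone of apex height [f p]; the
    cone raised by [c] therefore exceeds [f] by at most [c]. *)
Lemma cone_max_close f p (c : R) : Lip1 R d f -> closed_cube R d p -> 0 <= c ->
  forall y : set_type (closed_cube R d),
    `|f y - cone_max f p (zero_ext f p + c) y| <= c.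
Proof.
move=> Lf cp c0 y; have [u <- ->] := zero_ext_set_type f p cp.
have := Lf u y; rewrite /cone_max -euclidean_normN opprB.
rewrite !ler_norml => /andP[? ?].
by case: (leP (f y)) => ?; apply/andP; split; lra.
Qed.

(** On the ball of radius [c / 2] around [p], [f <= f p + c / 2] while the cone
    is at least [f p + c / 2], so the maximum is the cone. *)
Lemma cone_max_kink e f p (c : R) n : euclidean_norm e = 1 -> Lip1 R d f ->
  open_cube R d p -> 0 < c -> kink e (cone_max f p (zero_ext f p + c)) n p.
Proof.
move=> e1 Lf cp c0.
have apex z : closed_cube R d z -> euclidean_norm (z - p) <= c / 2 ->
    zero_ext (cone_max f p (zero_ext f p + c)) z = zero_ext f p + c - euclidean_norm (z - p).
  move=> cz zp; have := zero_ext_lip f z p Lf cz (open_cubeW _ cp).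
  have [u uz ->] := zero_ext_set_type (cone_max f p (zero_ext f p + c)) z cz.
  rewrite -uz zero_extE /cone_max uz ler_norml => /andP[_ ?].
  by apply: max_r; lra.
have near_cube (s : R) : \forall r \near (0 : R)^'+, open_cube R d (p + (s * r) *: e).
  have lim : p + (s * r) *: e @[r --> (0 : R)^'+] --> p + (s * 0) *: e.
    apply: cvg_at_right_filter; apply: cvgD; first exact: cvg_cst.
    by apply: cvgZr_tmp; apply: cvgMl_tmp; exact: cvg_id.
  move: lim; rewrite mulr0 scale0r addr0 => /(_ (open_cube R d)); apply.
  exact: open_nbhs_nbhs (conj open_open_cube cp).
have : \forall r \near (0 : R)^'+, [/\ 0 < r, r < n.+1%:R^-1, r < c / 2,
   open_cube R d (p + (1 * r) *: e) & open_cube R d (p + (-1 * r) *: e)].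
  near=> r; split.
  - by near: r; exact: nbhs_right_gt.
  - by near: r; apply: nbhs_right_lt; rewrite invr_gt0.
  - by near: r; apply: nbhs_right_lt; rewrite divr_gt0.
  - by near: r; exact: near_cube.
  - by near: r; exact: near_cube.
move=> /filter_ex[r [r0 rn rc]]; rewrite mul1r mulN1r scaleNr => cr cNr.
exists r; rewrite r0 rn; split=> //.
have nr : euclidean_norm (p + r *: e - p) = r.
  by rewrite addrAC subrr add0r euclidean_normZ e1 mulr1 gtr0_norm.
have nNr : euclidean_norm (p - r *: e - p) = r.
  by rewrite addrAC subrr add0r euclidean_normN euclidean_normZ e1 mulr1 gtr0_norm.
have n0 : euclidean_norm (p - p) = 0 by rewrite subrr euclidean_norm0.
rewrite /second_difference !apex ?nr ?nNr ?n0 ?(ltW rc) ?divr_ge0 ?(ltW c0)//;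
  do ?exact: open_cubeW.
(* The second difference at the apex is [- 2 r]. *)
by rewrite ltr_normr; apply/orP; right; lra.
Unshelve. all: by end_near. Qed.

End Kinks.

(** * Typical Lipschitz functions *)

Theorem corollary2p5 (R : realType) (d : nat) (hd : (1 <= d)%N)
    (S : set 'rV[R]_d) (hS : S `<=` open_cube R d) :
  exists F : set (cube_fun R d),
    [/\ F `<=` Lip1 R d, residual_in (Lip1 R d) F &
        forall f, F f -> residual_in S (S `&` non_differentiability f)].
Proof.
pose e : 'rV[R]_d := delta_mx ord0 (Ordinal hd).
have e1 : euclidean_norm e = 1%R.
  rewrite /euclidean_norm (bigD1 (Ordinal hd))//= big1.
    by rewrite addr0 mxE !eqxx expr1n sqrtr1.
  by move=> i ni; rewrite mxE (negbTE ni) andbF expr0n.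
have [D [cD DS dD]] := countable_dense_subset R d S.
exists (Lip1 R d `&` [set f | forall p n, D p -> kink e f n p]); split.
- exact: subIsetl.
- pose G (i : 'rV[R]_d * nat) : set (set_type (Lip1 R d)) :=
    set_val @^-1` [set f | kink e f i.2 i.1].
  apply: (@residual_countable_bigcap _ _ (D `*` [set: nat]) G).
  + apply: countableX => //; exact: countableP.
  + by move=> i _; exists [set f | kink e f i.2 i.1]; first exact: kink_open_fun.
  + move=> [p n] [/= Dp _] O [f Of] [W oW WO].
    have cp := hS _ (DS _ Dp).
    have Lf : Lip1 R d (set_val f) by exact: set_valP.
    have : nbhs (set_val f) W.
      by apply: open_nbhs_nbhs; split=> //; move: Of; rewrite -WO.
    move=> /uniform_nbhs[E []].
    rewrite -entourage_ballE => -[c /= c0 cE] EW.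
    (* A cone of height [c / 2] keeps [g] strictly within distance [c]. *)
    pose g := cone_max (set_val f) p (zero_ext (set_val f) p + c / 2).
    have c20 : (0 < c / 2)%R by rewrite divr_gt0.
    have Lg : Lip1 R d g by exact: cone_max_lip.
    exists (SigSub (mem_set Lg)); split; last exact: cone_max_kink.
    rewrite -WO; apply: EW => y _; apply: cE => /=.
    rewrite /ball/=; apply: le_lt_trans (cone_max_close _ _ _ Lf _ (ltW c20) y) _.
      exact: open_cubeW.
    by rewrite ltr_pdivrMr// ltr_pMr// ltr1n.
  + move=> f kf; split; first exact: set_valP.
    by move=> p n Dp; exact: (kf (p, n)).
- move=> f [Lf kf].
  pose G n : set (set_type S) := set_val @^-1` [set x | kink e f n x].
  apply: (@residual_countable_bigcap _ _ [set: nat] G).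
  + exact: countableP.
  + by move=> n _; exists [set x | kink e f n x]; first exact: kink_open_point.
  + move=> n _ O [x Ox] [W oW WO].
    have : nbhs (set_val x) W.
      by apply: open_nbhs_nbhs; split=> //; move: Ox; rewrite -WO.
    move=> /nbhs_ballP[r /= r0 rW].
    have [p Dp xp] := dD _ (set_valP x) _ r0.
    exists (SigSub (mem_set (DS _ Dp))); split; last exact: kf.
    by rewrite -WO; exact: rW.
  + move=> x kx; split; first exact: set_valP.
    by apply: (@kinks_nondifferentiable _ _ e) => n; exact: kx.
Qed.
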